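(* Let $L$ be an LL lattice, i.e. a finite lattice with a maximal chain $\Delta:\hat 0=x_0<x_1<\cdots<x_{n-1}<x_n=\hat 1$ all of whose elements are left-modular and for which the level condition holds. Then, with $A_1,\dots,A_n$ the levels of atoms induced by $\Delta$, the characteristic polynomial of $L$ factors as $$\chi(L,t)=\prod_{i=1}^n\bigl(t-|A_i|\bigr).$$
   Context: $L$ is a finite lattice with order $\le$, least element $\hat 0$, greatest element $\hat 1$ and atom set $A$. An element $x\in L$ is left-modular if $y\vee(x\wedge z)=(y\vee x)\wedge z$ for all $y\le z$ in $L$. Given a maximal chain $\Delta:\hat 0=x_0<x_1<\cdots<x_n=\hat 1$, the levels are $A_i=\{a\in A: a\le x_i \text{ but } a\not\le x_{i-1}\}$, $1\le i\le n$, which partition $A$. The partial order $\unlhd$ on $A$ induced by $\Delta$ is: $a\lhd b$ iff $a\in A_i$, $b\in A_j$ with $i<j$. The level condition (for $\Delta$) says: whenever $a\lhd b_1\lhd b_2\lhd\cdots\lhd b_k$ are atoms, then $a\not\le\bigvee_{i=1}^k b_i$. The generalized rank of $x\in L$ is $\rho(x)=$ the number of indices $i$ such that $A_i$ contains an atom $\le x$. The characteristic polynomial is $$\chi(L,t)=\sum_{x\in L}\mu(\hat 0,x)\,t^{\,n-\rho(x)},$$ where $n$ is the length of $\Delta$ and $\mu$ is the Möbius function of $L$. *)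

(* Defs.v *)
From HB Require Import structures.
From mathcomp Require Import all_boot all_order all_algebra.

Set Implicit Arguments.
Unset Strict Implicit.
Unset Printing Implicit Defensive.

Import Order.Theory GRing.Theory.

Section Mobius.
Local Open Scope order_scope.
Context {disp : Order.disp_t} {T : finPOrderType disp}.
Implicit Types x y : T.

(* The usual recursion mu(x, y) = [x = y] - \sum_(x <= z < y) mu(x, z), run with
   fuel k; #|T| steps always suffice (see mobiusE). *)
Fixpoint mobius_rec (k : nat) (x y : T) : int :=
  if k is k'.+1 then
    ((x == y)%:R - \sum_(z : T | ((x <= z) && (z < y))%O) mobius_rec k' x z)%R
  else 0%R.

Definition mobius x y : int := mobius_rec #|T| x y.

Lemma mobius_rec_stable k1 k2 x y :
  (#|[set z : T | (z <= y)%O]| <= k1)%N -> (#|[set z : T | (z <= y)%O]| <= k2)%N ->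
  mobius_rec k1 x y = mobius_rec k2 x y.
Proof.
have pos (v : T) : (0 < #|[set z : T | (z <= v)%O]|)%N.
  by apply/card_gt0P; exists v; rewrite inE.
elim: k1 k2 y => [|k1 IH] k2 y; first by rewrite leqNgt pos.
case: k2 => [|k2]; first by move=> _; rewrite leqNgt pos.
move=> h1 h2 /=; congr (_ - _)%R; apply: eq_bigr => z /andP[_ zy].
have lt : (#|[set w : T | (w <= z)%O]| < #|[set w : T | (w <= y)%O]|)%N.
  apply: proper_card; apply/properP; split.
    by apply/subsetP => w; rewrite !inE => /le_trans; apply; exact: ltW.
  by exists y; rewrite !inE // lt_geF.
by apply: IH; rewrite -ltnS; apply: leq_trans lt _.
Qed.

Lemma mobiusE x y :
  mobius x y =
  ((x == y)%:R - \sum_(z : T | ((x <= z) && (z < y))%O) mobius x z)%R.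
Proof.
rewrite {1}/mobius.
have bound (v : T) : (#|[set z : T | (z <= v)%O]| <= #|T|)%N by apply: max_card.
rewrite (@mobius_rec_stable _ #|T|.+1) //; exact: leqW.
Qed.

End Mobius.

Section Lattice.
Local Open Scope order_scope.
Context {disp : Order.disp_t} {L : finTBLatticeType disp}.

Definition left_modular (x : L) : Prop :=
  forall y z : L, y <= z -> y `|` (x `&` z) = (y `|` x) `&` z.

Definition atoms : {set L} :=
  [set a | (\bot < a) && [forall z : L, ~~ ((\bot < z) && (z < a))]].

Definition is_chain (C : {set L}) : bool :=
  [forall y in C, forall z in C, y >=< z].

Definition maximal_chain (n : nat) (x : 'I_n.+1 -> L) : Prop :=
  [/\ x ord0 = \bot, x ord_max = \top,
      forall i j : 'I_n.+1, (i < j)%N -> x i < x j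
    & maxset is_chain [set x i | i : 'I_n.+1]].

Section Levels.
Context {n : nat}.
Variable x : 'I_n.+1 -> L.

(* Levels are indexed from 0: for i : 'I_n, level i is the set A_{i+1} of atoms
   below x_{i+1} = x (lift ord0 i) but not below x_i = x (widen_ord _ i). *)
Definition level (i : 'I_n) : {set L} :=
  [set a in atoms | (a <= x (lift ord0 i)) && ~~ (a <= x (widen_ord (leqnSn n) i))].

Definition level_lt : rel L := fun a b =>
  [exists i : 'I_n, exists j : 'I_n, [&& a \in level i, b \in level j & (i < j)%N]].

Definition level_condition : Prop :=
  forall (a : L) (bs : seq L), bs != [::] -> {subset a :: bs <= atoms} ->
    path level_lt a bs -> ~~ (a <= \join_(b <- bs) b).

Definition gen_rank (y : L) : nat :=
  #|[set i : 'I_n | [exists a in level i, a <= y]]|.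

(* The truncated subtraction is exact, since gen_rank y <= n. *)
Definition characteristic_poly : {poly int} :=
  (\sum_(y : L) mobius \bot y *: 'X^(n - gen_rank y))%R.

Definition LL_chain : Prop :=
  [/\ maximal_chain x, forall i, left_modular (x i) & level_condition].

End Levels.
End Lattice.

(* Main.v *)
Require Import Defs.
From mathcomp Require Import all_boot all_order all_algebra.

Import GRing.Theory.
Local Open Scope ring_scope.

Set Implicit Arguments.
Unset Strict Implicit.
Unset Printing Implicit Defensive.

(** Both sides are the same sum over partial transversals, that is, over choices
    of at most one atom from each level. Expanding the product of the factors
    t - |A_i| gives the sum over partial transversals B of
    (-1)^|B| t^(n - |B|), so two facts are needed.

    The first ([mobius_transversals]) is that mu(0, y) is the sum of (-1)^|B|
    over the partial transversals B with join y. By Moebius inversion it is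
    enough to sum over all B with join at most y ([sum_sign_le]). This sum is
    the product over the levels of 1 - |{a in A_i : a <= y}|, so for y <> 0 it
    vanishes as soon as some level has exactly one atom below y. The lowest
    level meeting the atoms below y is such a level ([lowest_level_singleton]):
    if it had two atoms a and b, left-modularity would yield an atom of lower
    level below their join, hence below y.

    The second ([gen_rank_transversal]) is that the join of B has generalized
    rank |B|, that is, no level avoided by B has an atom a below that join.
    Given such an a, let y be the join of the part of B in levels above that of
    a. By the level condition a is not below y, and left-modularity then gives
    an atom d of lower level than a below y \/ a; but this contradicts the
    level condition for d, a and that part of B.

    Both arguments use left-modularity in the same way
    ([left_modular_atom_below]). *)

(** * Finite posets and lattices *)

Section FinitePosets.
Local Open Scope order_scope.
Import Order.TTheory.

(** Moebius inversion, in the form of a characterization: the defining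
    recursion has only one solution, by induction on the size of the down-set
    of y. *)
Lemma mobius_unique (disp : Order.disp_t) (T : finPOrderType disp) (x : T)
    (g : T -> int) :
    (forall y : T, (\sum_(z : T | (x <= z <= y)%O) g z = (x == y)%:R)%R) ->
  forall y : T, x <= y -> g y = mobius x y.
Proof.
move=> gsum y; have [k] := ubnP #|[set z : T | z <= y]|.
elim: k y => // k IH y ltk xy.
rewrite mobiusE -gsum (bigD1 y) ?xy ?lexx //=.
rewrite [X in (_ + X - _)%R](eq_bigl (fun z => x <= z < y)); last first.
  by move=> z; rewrite lt_neqAle -andbA [(z != y) && _]andbC.
rewrite [X in (_ - X)%R](eq_bigr g) ?addrK // => z /andP[xz zy].
apply/esym/IH => //; rewrite -ltnS.
apply: leq_trans ltk; rewrite ltnS; apply: proper_card; apply/properP; split.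
  by apply/subsetP => w; rewrite !inE => /le_trans; apply; exact: ltW.
by exists y; rewrite !inE // lt_geF.
Qed.

Lemma atom_le (disp : Order.disp_t) (L : finTBLatticeType disp) (y : L) :
  y != \bot -> exists2 a, a \in atoms & a <= y.
Proof.
have [k] := ubnP #|[set z : L | z <= y]|.
elim: k y => // k IH y ltk y0.
have [/forallP ymin|] := boolP [forall z : L, ~~ ((\bot < z) && (z < y))].
  by exists y; rewrite // inE lt0x y0; apply/forallP.
rewrite negb_forall => /existsP[z]; rewrite negbK lt0x => /andP[z0 zy].
have [|a aA az] := IH z _ z0; last by exists a => //; exact: le_trans az (ltW zy).
rewrite -ltnS; apply: leq_trans ltk; rewrite ltnS.
apply: proper_card; apply/properP; split.
  by apply/subsetP => w; rewrite !inE => /le_trans; apply; exact: ltW.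
by exists y; rewrite !inE // lt_geF.
Qed.

End FinitePosets.

(** * Levels of a maximal chain *)

Section LeftModularChain.
Local Open Scope order_scope.
Import Order.TTheory.
Context {disp : Order.disp_t} {L : finTBLatticeType disp} {n : nat}.
Variable x : 'I_n.+1 -> L.
Implicit Types (i j : 'I_n) (a b y z : L) (f : {ffun 'I_n -> L}).

Let lo i : L := x (widen_ord (leqnSn n) i).
Let hi i : L := x (lift ord0 i).

Hypothesis xmax : maximal_chain x.

Let x_le (i j : 'I_n.+1) : (i <= j)%N -> x i <= x j.
Proof.
case: xmax => _ _ mono _; rewrite leq_eqVlt => /orP[/eqP/val_inj-> //|/mono].
exact: ltW.
Qed.

Lemma hi_le_lo i j : (i < j)%N -> hi i <= lo j.
Proof. by move=> ij; apply: x_le. Qed.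

Lemma levelP i a : reflect [/\ a \in atoms, a <= hi i & ~~ (a <= lo i)]
  (a \in level x i).
Proof. by rewrite [_ \in level _ _]in_set; apply: and3P. Qed.

Lemma level_neq0 i a : a \in level x i -> a != \bot.
Proof. by case/levelP=> _ _; apply: contraNneq => ->; exact: le0x. Qed.

Lemma atom_level a : a \in atoms -> exists i, a \in level x i.
Proof.
move=> aA; case: (xmax) => x0 x1 _ _.
have ex : exists k, a <= x (inord k).
  exists n; suff -> : inord n = ord_max :> 'I_n.+1 by rewrite x1 lex1.
  by apply: val_inj; rewrite /= inordK.
have aneq0 : a != \bot by move: aA; rewrite inE lt0x => /andP[].
case: (ex_minnP ex) => -[|k] ak kmin.
  move: ak; suff -> : inord 0 = ord0 :> 'I_n.+1 by rewrite x0 lex0 (negPf aneq0).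
  by apply: val_inj; rewrite /= inordK.
have kn : (k < n)%N.
  apply: (kmin n); suff -> : inord n = ord_max :> 'I_n.+1 by rewrite x1 lex1.
  by apply: val_inj; rewrite /= inordK.
exists (Ordinal kn); apply/levelP; split=> //.
  by suff -> : hi (Ordinal kn) = x (inord k.+1) => //;
     congr x; apply: val_inj; rewrite /= inordK.
apply/negP => alo; suff /kmin : a <= x (inord k) by rewrite ltnn.
suff -> : inord k = widen_ord (leqnSn n) (Ordinal kn) by [].
by apply: val_inj; rewrite /= inordK // ltnW.
Qed.

Lemma le_lo_level i j a : a \in level x i -> a <= lo j -> (i < j)%N.
Proof.
move=> /levelP[_ _ nlo] alo; rewrite ltnNge; apply: contra nlo => ji.
by apply: le_trans alo _; apply: x_le.
Qed.

(** The join lies strictly above [lo i] and at most at [hi i], so it is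
    comparable to the whole chain; by maximality it belongs to the chain, and
    [hi i] is the only value left. *)
Lemma level_joinE i a : a \in level x i -> lo i `|` a = hi i.
Proof.
move=> /levelP[_ ahi nlo]; case: (xmax) => _ _ _ /maxsetP[ch mx].
have le_w : lo i `|` a <= hi i by rewrite leUx ahi andbT; apply: x_le.
set w := lo i `|` a in le_w *.
have cmp (j : 'I_n.+1) : x j >=< w.
  case: (leqP j i) => ij.
    by apply/orP; left; apply: le_trans (leUl _ _); apply: x_le.
  by apply/orP; right; apply: le_trans le_w _; apply: x_le.
have /mx : is_chain (w |: [set x j | j : 'I_n.+1]).
  apply/forall_inP => y yC; apply/forall_inP => z zC.
  move: yC zC; rewrite !in_setU1 => /orP[/eqP->|yC] /orP[/eqP->|zC].
  - exact: comparablexx.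
  - by case/imsetP: zC => j _ ->; rewrite comparable_sym.
  - by case/imsetP: yC => j _ ->.
  - by move/forall_inP: ch => /(_ y yC)/forall_inP; apply.
move=> /(_ (subsetUr _ _)) eqC.
have : w \in [set x j | j : 'I_n.+1] by rewrite -eqC setU11.
case/imsetP=> j _ wj; apply/eqP; rewrite eq_le le_w /= wj.
apply: x_le; rewrite lift0 ltnNge; apply: contra nlo => ji.
by apply: le_trans (leUr a (lo i)) _; rewrite -/w wj; apply: x_le.
Qed.

(** * Left-modularity and the lowest level *)

Hypothesis xlm : forall i : 'I_n.+1, left_modular (x i).

(** Left-modularity of [lo i] says y \/ (lo i /\ z) = (y \/ lo i) /\ z = z, and
    z <> y forces lo i /\ z to be nonzero; any atom below it works. *)
Lemma left_modular_atom_below i y z : y < z -> z <= y `|` lo i ->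
  exists j : 'I_n, (j < i)%N /\ exists2 d, d \in level x j & d <= z.
Proof.
move=> yz zle; have := xlm (widen_ord (leqnSn n) i) (ltW yz); rewrite -/(lo i).
rewrite [RHS](meet_idPr zle) => eqz.
have /atom_le[d dA] : lo i `&` z != \bot.
  by apply: contraTneq yz => m0; rewrite -eqz m0 joinx0 ltxx.
rewrite lexI => /andP[dlo dz]; have [j dj] := atom_level dA.
by exists j; split; [exact: le_lo_level dj dlo | exists d].
Qed.

(** Two atoms a and b of the lowest level i would both be below
    lo i \/ a = hi i, so [left_modular_atom_below] applied to a < a \/ b would
    produce an atom below y of a still lower level. *)
Lemma lowest_level_singleton y : y != \bot ->
  exists i, #|[set a in level x i | a <= y]| = 1%N.
Proof.
case/atom_le=> a0 a0A a0y; have [i0 ai0] := atom_level a0A.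
pose P (i : 'I_n) := [exists a in level x i, a <= y].
have Pi0 : P i0 by apply/exists_inP; exists a0.
case: (arg_minnP (fun i : 'I_n => val i) Pi0) => i /exists_inP[a ai ay] imin.
exists i; apply/eqP/cards1P; exists a; apply/setP => b.
rewrite [LHS]in_set in_set1.
apply/andP/eqP => [[bi yb]|->]; last by [].
apply/eqP/negPn/negP => ba.
have hiE := level_joinE ai; have /levelP[bA bhi _] := bi.
have /levelP[aA _ _] := ai.
have lt : a < a `|` b.
  rewrite lt_neqAle leUl andbT; apply/negP => /eqP aE.
  have ltba : b < a by rewrite lt_neqAle ba aE leUr.
  move: aA; rewrite inE => /andP[_ /forallP/(_ b)].
  by rewrite ltba lt0x (level_neq0 bi).
have [|j [ji [d dj dle]]] := @left_modular_atom_below i _ _ lt.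
  by rewrite leUx leUl joinC hiE.
have /imin : P j.
  by apply/exists_inP; exists d => //; apply: le_trans dle _; rewrite leUx ay.
by rewrite leqNgt ji.
Qed.

(** * Partial transversals and the Moebius function *)

(** A partial transversal is encoded as a function on the levels, the value
    [\bot] meaning that no atom is chosen. This makes its set of atoms
    unambiguous, since [\bot] is in no level, does not affect joins, and turns
    the sum over transversals into an expanded product. *)
Definition transversal_choices i : {set L} := \bot |: level x i.

Definition partial_transversal f := f \in family transversal_choices.

Lemma partial_transversalP f i :
  partial_transversal f -> f i != \bot -> f i \in level x i.
Proof. by move/familyP => /(_ i); rewrite in_setU1 => /orP[->|]. Qed.

Definition join_of f : L := \join_j f j.

Definition choice_sign b : int := if b == \bot then 1%R else (-1)%R.

(** One factor of the expanded products: u = 1 gives the sums of signs and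
    u = 'X gives the factors of the characteristic polynomial. *)
Lemma sum_choices (R : pzRingType) (P : pred L) i (u : R) : P \bot ->
  (\sum_(b in transversal_choices i | P b) (if b == \bot then u else -1)
    = u - #|[set a in level x i | P a]|%:R :> R)%R.
Proof.
move=> P0; rewrite (bigD1 \bot) ?P0 ?setU11 //= eqxx; congr (_ + _)%R.
rewrite (eq_bigl (fun b => b \in [set a in level x i | P a])) => [|b]; last first.
  rewrite [RHS]in_set in_setU1; case: eqVneq => [->|_]; last by rewrite andbT.
  by rewrite andbF; case: (boolP (_ \in _)) => // /level_neq0; rewrite eqxx.
rewrite (eq_bigr (fun _ => (-1)%R)) => [|b].
  by rewrite sumr_const mulNrn.
by rewrite [_ \in _]in_set => /andP[/level_neq0/negPf->].
Qed.

(** The join is at most y iff every chosen atom is, so the sum factors over the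
    levels; the factor of the lowest level below y is 1 - 1 = 0. *)
Lemma sum_sign_le y :
  (\sum_(f : {ffun 'I_n -> L} | partial_transversal f && (join_of f <= y)%O)
     \prod_i choice_sign (f i)
    = (\bot == y)%:R)%R.
Proof.
have -> : (\sum_(f : {ffun 'I_n -> L} | partial_transversal f && (join_of f <= y)%O)
   \prod_i choice_sign (f i)
   = \prod_i (1 - #|[set a in level x i | (a <= y)%O]|%:R))%R.
  transitivity (\prod_i \sum_(b in transversal_choices i | (b <= y)%O)
                  choice_sign b)%R; last first.
    by apply: eq_bigr => i _; apply: sum_choices; apply: le0x.
  rewrite bigA_distr_big_dep; apply: eq_bigl => f.
  apply/andP/familyP => [[/familyP tf /joinsP le] i | tf].
    by apply/andP; split; [exact: tf | exact: le].
  by split; [apply/familyP => i | apply/joinsP => i _]; case/andP: (tf i).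
have [<-|y0] := eqVneq \bot y.
  rewrite big1 // => i _; suff -> : [set a in level x i | a <= \bot] = set0.
    by rewrite cards0 subr0.
  apply/setP => a; rewrite [LHS]in_set in_set0 lex0.
  by apply/andP => -[/level_neq0/negP].
have [|i i1] := @lowest_level_singleton y; first by rewrite eq_sym.
by apply/eqP/prodf_eq0; exists i; rewrite // i1 subrr.
Qed.

Lemma mobius_transversals y :
  (mobius \bot y =
   \sum_(f : {ffun 'I_n -> L} | partial_transversal f && (join_of f == y))
     \prod_i choice_sign (f i))%R.
Proof.
symmetry; apply: (@mobius_unique _ _ \bot
  (fun y => \sum_(f : {ffun 'I_n -> L} | partial_transversal f && (join_of f == y))
     \prod_i choice_sign (f i))%R); last exact: le0x.
move=> {}y; rewrite -sum_sign_le.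
rewrite [RHS](partition_big join_of (fun z => \bot <= z <= y)).
  apply: eq_bigr => z /andP[_ zy]; apply: eq_bigl => f.
  by rewrite -andbA; case: eqP => [->|_]; rewrite ?zy ?andbF.
by move=> f /andP[_ ->]; rewrite le0x.
Qed.

(** * The level condition and the generalized rank *)

Hypothesis xlc : level_condition x.

(** The atoms chosen in levels above i, listed by level, form with a an
    increasing sequence as in the level condition. *)
Lemma level_condition_transversal f i a : partial_transversal f ->
  a \in level x i -> ~~ (a <= \join_(j : 'I_n | (i < j)%N) f j).
Proof.
move=> tf ai; pose s := [seq j : 'I_n <- enum 'I_n | (i < j)%N && (f j != \bot)].
have sP (j : 'I_n) : j \in s -> (i < j)%N /\ f j \in level x j.
  by rewrite mem_filter => /andP[/andP[ij /(partial_transversalP tf)]].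
have joinE : \join_(j : 'I_n | (i < j)%N) f j <= \join_(b <- map f s) b.
  apply/joinsP => j ij; have [->|fj] := eqVneq (f j) \bot; first exact: le0x.
  have js : f j \in map f s by rewrite map_f // mem_filter ij fj mem_enum.
  by have /joinsP_seq/(_ _ js isT) := lexx (\join_(b <- map f s) b).
apply: contra (fun h => le_trans h joinE) _.
have [s0|sn0] := eqVneq s [::].
  by rewrite s0 big_nil lex0 (level_neq0 ai).
apply: xlc.
- by case: (s) sn0.
- move=> b; rewrite inE => /predU1P[->|/mapP[j /sP[_ /levelP[? _ _]] ->] //].
  by case/levelP: ai.
suff /pairwise_sorted : pairwise (level_lt x) (a :: map f s) by [].
rewrite /= pairwise_map; apply/andP; split.
  apply/allP => _ /mapP[j /sP[ij fj] ->].
  by apply/existsP; exists i; apply/existsP; exists j; rewrite ai fj ij.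
have : pairwise (relpre val ltn) s.
  apply: pairwise_filter; rewrite -pairwise_map val_enum_ord.
  by rewrite -sorted_pairwise ?iota_ltn_sorted //; exact: ltn_trans.
apply: (@sub_in_pairwise _ (mem s)); last exact/allP.
move=> j k /sP[_ fj] /sP[_ fk] jk.
by apply/existsP; exists j; apply/existsP; exists k; rewrite fj fk.
Qed.

(** If f chose nothing at level i, the atoms it chooses below level i would be
    under [lo i], so that a <= y \/ lo i with y the join of those above. *)
Lemma level_le_join f i a : partial_transversal f -> a \in level x i ->
  a <= join_of f -> f i != \bot.
Proof.
move=> tf ai; apply: contraTneq => fi0; apply/negP => aj.
set y := \join_(j : 'I_n | (i < j)%N) f j.
have ltz : y < y `|` a.
  rewrite lt_neqAle leUl andbT; apply/negP => /eqP yE.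
  by have := level_condition_transversal tf ai; rewrite -/y yE leUr.
have [|k [ki [d dk dle]]] := @left_modular_atom_below i _ _ ltz.
  rewrite leUx leUl; apply: le_trans aj _; apply/joinsP => j _.
  case: (ltngtP j i) => [ji|ij|/val_inj->]; last by rewrite fi0 le0x.
    have [->|/(partial_transversalP tf)/levelP[_ fhi _]] := eqVneq (f j) \bot.
      exact: le0x.
    by apply: le_trans fhi _; apply: le_trans (hi_le_lo ji) (leUr _ _).
  by apply: le_trans (leUl _ _); apply: joins_sup.
(* Adding a to f makes the level condition for d apply to a and y at once. *)
pose g := [ffun j => if j == i then a else f j].
have tg : partial_transversal g.
  apply/familyP => j; rewrite ffunE; case: eqP => [->|_].
    by rewrite in_setU1 ai orbT.
  by move/familyP: tf; apply.
have /negP[] := level_condition_transversal tg dk.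
apply: le_trans dle _; rewrite leUx; apply/andP; split.
  apply/joinsP => j ij; apply: joins_min (ltn_trans ki ij) _.
  by rewrite ffunE; case: eqP => [ji|//]; rewrite ji ltnn in ij.
by apply: joins_min ki _; rewrite ffunE eqxx.
Qed.

Lemma gen_rank_transversal f : partial_transversal f ->
  gen_rank x (join_of f) = #|[set i | f i != \bot]|.
Proof.
move=> tf; congr #|pred_of_set _|; apply/setP => i; rewrite !inE.
apply/exists_inP/idP => [[a ai]|fi]; first exact: level_le_join.
by exists (f i); [exact: partial_transversalP | exact: joins_sup].
Qed.

End LeftModularChain.

(** * The factorization *)

(** The signs and the powers of 'X attached to a partial transversal combine
    into one product, in which P marks the levels where nothing is chosen. *)
Lemma sign_monomial_prod (I : finType) (P : pred I) :
  (\prod_i (if P i then 1 else -1 : int)) *: 'X^(#|I| - #|[set i | ~~ P i]|)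
  = \prod_i (if P i then 'X else -1) :> {poly int}.
Proof.
have -> : (#|I| - #|[set i | ~~ P i]|)%N = #|[set i | P i]|.
  rewrite -(cardsC [set i | P i]) (_ : ~: _ = [set i | ~~ P i]) ?addnK //.
  by apply/setP => i; rewrite !inE.
rewrite -prodr_const [X in _ *: X]big_mkcond -mul_polyC rmorph_prod -big_split /=.
apply: eq_bigr => i _; rewrite inE.
by case: ifP => _; rewrite ?mul1r ?mulr1 ?rmorphN.
Qed.

Theorem theorem6p5 (disp : Order.disp_t) (L : finTBLatticeType disp)
    (n : nat) (x : 'I_n.+1 -> L) (hLL : LL_chain x) :
  characteristic_poly x = \prod_(i < n) ('X - (#|level x i|%:R)%:P).
Proof.
case: hLL => xmax xlm xlc; rewrite /characteristic_poly.
transitivity (\sum_(f : {ffun 'I_n -> L} | partial_transversal x f)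
    \prod_(i < n) (if f i == Order.bottom then 'X else -1) : {poly int}).
  rewrite (partition_big (@join_of _ _ _) xpredT) //=.
  apply: eq_bigr => y _; rewrite (mobius_transversals xmax xlm) scaler_suml.
  apply: eq_bigr => f /andP[tf /eqP <-].
  rewrite (gen_rank_transversal xmax xlm xlc tf).
  have := sign_monomial_prod (fun i => f i == Order.bottom).
  by rewrite card_ord.
transitivity (\prod_i \sum_(b in transversal_choices x i)
    (if b == Order.bottom then 'X else -1) : {poly int}).
  by rewrite bigA_distr_big_dep.
apply: eq_bigr => i _.
rewrite polyC_natr.
have := @sum_choices _ _ _ x {poly int} xpredT i 'X isT.
rewrite (_ : [set a in level x i | true] = level x i) => [<-|].
  by apply: eq_bigl => b; rewrite andbT.
by apply/setP => a; rewrite inE andbT.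
Qed.
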